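(* Let $p$ and $q$ be prime numbers such that $2 < p < q$. Then the Wiener index of the line graph $L(\Gamma(\mathbb{Z}_{pq}))$ is $W(L(\Gamma(\mathbb{Z}_{pq}))) = \dfrac{1}{2}(p-1)(q-1)(2pq-3p-3q+4)$.
   Context: For a positive integer $n$, $\mathbb{Z}_n$ is the ring of residue classes modulo $n$. The zero-divisor graph $\Gamma(\mathbb{Z}_n)$ is the simple undirected graph whose vertices are the nonzero zero-divisors of $\mathbb{Z}_n$ (nonzero $x \in \mathbb{Z}_n$ such that $xy = 0$ for some nonzero $y \in \mathbb{Z}_n$), with distinct vertices $x,y$ adjacent if and only if $xy=0$. The line graph $L(\Gamma(\mathbb{Z}_n))$ is the graph whose vertices are the edges of $\Gamma(\mathbb{Z}_n)$, two distinct vertices being adjacent if the corresponding edges share a common vertex in $\Gamma(\mathbb{Z}_n)$. The Wiener index of a finite connected graph $G$ with vertex set $V$ is $W(G) = \frac{1}{2}\sum_{x,y \in V} d(x,y)$, the sum being over all ordered pairs $(x,y)$, where $d(x,y)$ is the length of a shortest path between $x$ and $y$. *)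

(* Defs.v *)
From HB Require Import structures.
From mathcomp Require Import all_boot all_order all_algebra.

Set Implicit Arguments.
Unset Strict Implicit.
Unset Printing Implicit Defensive.

Import GRing.Theory.

Record sgraph := SGraph {
  svertex :> finType;
  adj : rel svertex;
  adj_sym : symmetric adj;
  adj_irrefl : irreflexive adj }.

Definition has_path (G : sgraph) (x y : G) (k : nat) : bool :=
  [exists w : k.-tuple G,
     [&& path (@adj G) x w, last x w == y & uniq (x :: w)]].

(* A path has fewer than #|G| edges, so searching k < #|G| loses nothing. If no
   path joins x and y, the value is #|G|; this never occurs in a connected
   graph, the only case in which the Wiener index is meaningful. *)
Definition dist (G : sgraph) (x y : G) : nat :=
  find (has_path x y) (iota 0 #|G|).

Definition wiener_index (G : sgraph) : rat :=
  (1 / 2 * \sum_(x : G) \sum_(y : G) (dist x y)%:R)%R.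

Definition is_edge (G : sgraph) (A : {set G}) : bool :=
  [exists x : G, exists y : G, adj x y && (A == [set x; y])].

Section LineGraph.
Variable G : sgraph.

Definition line_vertex : finType := {A : {set G} | is_edge A}.

Definition line_adj : rel line_vertex :=
  fun A B => (A != B) && (val A :&: val B != set0).

Lemma line_adj_sym : symmetric line_adj.
Proof. by move=> A B; rewrite /line_adj eq_sym setIC. Qed.

Lemma line_adj_irrefl : irreflexive line_adj.
Proof. by move=> A; rewrite /line_adj eqxx. Qed.

Definition line_graph : sgraph := SGraph line_adj_sym line_adj_irrefl.

End LineGraph.

Section ZeroDivisorGraph.
Variable R : finComNzRingType.

Definition nz_zero_divisor (x : R) : bool :=
  (x != 0%R) && [exists y : R, (y != 0%R) && (x * y == 0)%R].

Definition zd_vertex : finType := {x : R | nz_zero_divisor x}.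

Definition zd_adj : rel zd_vertex :=
  fun x y => (x != y) && (val x * val y == 0)%R.

Lemma zd_adj_sym : symmetric zd_adj.
Proof. by move=> x y; rewrite /zd_adj eq_sym mulrC. Qed.

Lemma zd_adj_irrefl : irreflexive zd_adj.
Proof. by move=> x; rewrite /zd_adj eqxx. Qed.

Definition zero_divisor_graph : sgraph := SGraph zd_adj_sym zd_adj_irrefl.

End ZeroDivisorGraph.

(* Main.v *)
(** By the Chinese remainder theorem the nonzero zero-divisors of Z_{pq} are the
    nonzero multiples of [p] and the nonzero multiples of [q], and the graph is
    complete bipartite between these two classes, of sizes [q-1] and [p-1].
    Hence its line graph is a rook's graph: the vertices are pairs [(a, b)], and
    the distance of two pairs is the number of coordinates in which they differ.
    Summing the two coordinates separately gives the index. *)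
Require Import Defs.
From mathcomp Require Import all_boot all_order all_algebra.
From mathcomp Require Import ring zify.

Import GRing.Theory.

(** * Shortest paths of length at most two *)

Section Distance.
Variable G : sgraph.
Implicit Types x y z : G.

(** A path of length [k] visits [k + 1] distinct vertices, so [k] lies in the range that [find]
    searches and the default value [#|G|] cannot occur. *)
Lemma dist_eq x y k :
  has_path x y k -> (forall j, j < k -> ~~ has_path x y j) -> dist x y = k.
Proof.
move=> Hk Hlt.
have kG : k < #|G|.
  case/existsP: Hk => w /and3P[_ _ U].
  by have := max_card (mem (x :: w)); rewrite (card_uniqP U) /= size_tuple.
have Hhas : has (has_path x y) (iota 0 #|G|).
  by apply/hasP; exists k => //; rewrite mem_iota.
rewrite /dist; set i := find _ _.
have iG : i < #|G| by move: Hhas; rewrite has_find size_iota.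
have := nth_find 0 Hhas; rewrite -/i nth_iota // add0n => Hi.
case: (ltngtP i k) => // [ik|ki]; first by have := Hlt _ ik; rewrite Hi.
by have := before_find 0 ki; rewrite nth_iota // add0n Hk.
Qed.

Lemma has_path0 x y : has_path x y 0 = (x == y).
Proof.
apply/existsP/idP => [[w]|xy]; first by rewrite tuple0 /= => /andP[].
by exists [tuple] => /=; rewrite xy.
Qed.

Lemma has_path1 x y : has_path x y 1 = adj x y.
Proof.
apply/existsP/idP => [[w]|xy].
  by case/tupleP: w => z w; rewrite tuple0 /= => /and3P[/andP[? _] /eqP <-].
exists [tuple y] => /=; rewrite xy eqxx inE /= !andbT.
by apply: contraTneq xy => ->; rewrite adj_irrefl.
Qed.

Lemma dist_refl x : dist x x = 0.
Proof. by apply: dist_eq => //; rewrite has_path0. Qed.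

Lemma dist_adj x y : adj x y -> dist x y = 1.
Proof.
move=> xy; apply: dist_eq => [|[|//] _]; first by rewrite has_path1.
by rewrite has_path0; apply: contraTneq xy => ->; rewrite adj_irrefl.
Qed.

Lemma dist_two x y z :
  x != y -> ~~ adj x y -> adj x z -> adj z y -> dist x y = 2.
Proof.
move=> xy nxy xz zy; apply: dist_eq => [|[|[|//]] _].
- apply/existsP; exists [tuple z; y] => /=.
  rewrite xz zy eqxx !inE !negb_or xy !andbT /=.
  apply/andP; split; [apply: contraTneq xz | apply: contraTneq zy] => ->;
  by rewrite adj_irrefl.
- by rewrite has_path0.
- by rewrite has_path1.
Qed.

End Distance.

(** * Line graph of a complete bipartite graph with classes [A] and [~: A] *)

Section CompleteBipartite.
Variables (G : sgraph) (A : {set G}).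
Hypothesis adjE : forall x y : G, adj x y = ((x \in A) != (y \in A)).

Lemma is_edge_bipartite (S : {set G}) :
  is_edge S = (S \in [set [set x.1; x.2] | x in setX A (~: A)]).
Proof.
apply/idP/imsetP => [/existsP[x /existsP[y /andP[xy /eqP ->]]]|[[x y]]].
  move: xy; rewrite adjE; case xA: (x \in A); case yA: (y \in A) => // _.
    by exists (x, y); rewrite // !inE xA yA.
  by exists (y, x); rewrite /= 1?setUC // !inE xA yA.
rewrite !inE /= => /andP[xA yA] ->; apply/existsP; exists x.
by apply/existsP; exists y; rewrite adjE xA (negbTE yA) /=.
Qed.

(** Edges are unordered sets; the two intersections serve as their coordinates in the rook's
    graph. *)
Lemma pair_set_inter (a b : G) : a \in A -> b \notin A ->
  ([set a; b] :&: A = [set a]) * ([set a; b] :&: ~: A = [set b]).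
Proof.
move=> aA bA; split; apply/setP=> z; rewrite !inE.
  by case: eqVneq => [->|_]; rewrite ?aA //=; case: eqVneq => // ->; apply/negbTE.
by case: eqVneq => [->|_] /=; case: eqVneq => [->|] //; rewrite ?bA // aA.
Qed.

Lemma dist_line_bipartite (e f : line_graph G) :
  dist e f = (val e :&: A != val f :&: A) + (val e :&: ~: A != val f :&: ~: A).
Proof.
have vE (g h : line_vertex G) : (g == h) = (val g == val h) by [].
have [] : is_edge (val e) /\ is_edge (val f) by split; apply: valP.
have key a b : a \in A -> b \notin A ->
    exists g : line_graph G, val g = [set a; b].
  move=> aA bA; have E : is_edge [set a; b].
    by rewrite is_edge_bipartite; apply/imsetP; exists (a, b); rewrite // !inE aA.
  by exists (Sub [set a; b] E); rewrite SubK.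
rewrite !is_edge_bipartite => /imsetP[[a b]]; rewrite !inE /=.
move=> /andP[aA bA] eE /imsetP[[c d]]; rewrite !inE /= => /andP[cA dA] fE.
rewrite eE fE !pair_set_inter // !(inj_eq set1_inj).
have ad : a != d by apply: contraTneq aA => ->.
have bc : b != c by apply: contraNneq bA => ->.
have adjef : adj e f = ([set a; b] != [set c; d]) && ((a == c) || (b == d)).
  rewrite /= /line_adj vE /= eE fE; congr (_ && _).
  apply/set0Pn/orP => [[z]|[/eqP->|/eqP->]].
  - rewrite !inE => /andP[/orP[]/eqP-> ]; rewrite ?(negbTE ad) ?(negbTE bc) ?orbF.
      by left.
    by right.
  - by exists c; rewrite !inE eqxx.
  - by exists d; rewrite !inE eqxx !orbT.
have ef : ([set a; b] == [set c; d]) = (a == c) && (b == d).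
  apply/eqP/andP => [E|[/eqP-> /eqP->]] //.
  have := pair_set_inter c d cA dA; rewrite -E !pair_set_inter // => -[].
  by move=> /set1_inj -> /set1_inj ->.
case: (eqVneq a c) (eqVneq b d) => [ac|ac] [bd|bd] /=.
- have -> : e = f by apply: val_inj; rewrite /= eE fE ac bd.
  exact: dist_refl.
- by apply: dist_adj; rewrite adjef ef (negbTE bd) ac eqxx andbF.
- by apply: dist_adj; rewrite adjef ef (negbTE ac) bd eqxx orbT.
(* Both coordinates differ, so the edges are disjoint; by completeness the mixed pair [[set a; d]]
   is an edge, and it meets both. *)
have [g /= gE] := key a d aA dA.
apply: (@dist_two _ _ _ g).
- by rewrite vE /= eE fE ef (negbTE ac).
- by rewrite adjef (negbTE ac) (negbTE bd) andbF.
- rewrite /= /line_adj vE /= eE gE; apply/andP; split.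
    apply: contra bd => /eqP E; have := pair_set_inter a d aA dA.
    by rewrite -E !pair_set_inter // => -[_ /set1_inj ->].
  by apply/set0Pn; exists a; rewrite !inE eqxx.
rewrite /= /line_adj vE /= gE fE; apply/andP; split.
  apply: contra ac => /eqP E; have := pair_set_inter a d aA dA.
  by rewrite E !pair_set_inter // => -[/set1_inj -> _].
by apply/set0Pn; exists d; rewrite !inE eqxx !orbT.
Qed.

(** The two ends of an edge can be recovered by intersection, so the map from pairs to edges is
    injective and the sum can be reindexed. Taking [F] on bare sets keeps edge proofs out of the
    summand. *)
Lemma sum_line_bipartite (F : {set G} -> nat) :
  \sum_(e : line_graph G) F (val e) =
  \sum_(a in A) \sum_(b in ~: A) F [set a; b].
Proof.
rewrite -(big_sub (@is_edge G)) (eq_bigl _ _ is_edge_bipartite) big_imset.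
  by rewrite pair_big_dep /=; apply: eq_bigl => -[a b]; rewrite in_setX.
move=> [a b] [c d]; rewrite !inE /= => /andP[aA bA] /andP[cA dA] E.
have := pair_set_inter a b aA bA; rewrite E !pair_set_inter // => -[].
by move=> /set1_inj -> /set1_inj ->.
Qed.

(** From a fixed edge, the first coordinate changes in [(#|A|).-1 * #|~: A|] edges and the second in
    [#|A| * (#|~: A|).-1], whichever edge was fixed. *)
Lemma sum_dist_line_bipartite :
  \sum_(e : line_graph G) \sum_(f : line_graph G) dist e f =
  #|A| * #|~: A| * ((#|A|).-1 * #|~: A| + #|A| * (#|~: A|).-1).
Proof.
have sum_neq (B : {set G}) (b : G) : b \in B -> \sum_(d in B) (b != d) = (#|B|).-1.
  move=> bB; rewrite (cardsD1 b B) bB /= -sum1_card big_mkcond [RHS]big_mkcond /=.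
  by apply: eq_bigr => d _; rewrite !inE eq_sym; case: (d \in B); case: (d == b).
(* [D] extends the distance formula to arbitrary sets, so that both sums over edges can be
   reindexed. *)
pose D (S T : {set G}) := (S :&: A != T :&: A) + (S :&: ~: A != T :&: ~: A).
pose H S := \sum_(f : line_graph G) D S (val f).
transitivity (\sum_(e : line_graph G) H (val e)).
  by apply: eq_bigr => e _; apply: eq_bigr => f _; apply: dist_line_bipartite.
rewrite sum_line_bipartite -mulnA -sum_nat_const; apply: eq_bigr => a aA.
rewrite -sum_nat_const; apply: eq_bigr => b; rewrite inE => bA.
rewrite /H sum_line_bipartite.
transitivity (\sum_(c in A) ((a != c) * #|~: A| + (#|~: A|).-1)).
  apply: eq_bigr => c cA; rewrite -(@sum_neq _ b) ?inE // mulnC -sum_nat_const.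
  rewrite -big_split; apply: eq_bigr => d; rewrite inE => dA.
  by rewrite /D !pair_set_inter // !(inj_eq set1_inj).
by rewrite big_split /= -big_distrl sum_nat_const /= sum_neq.
Qed.

Lemma wiener_line_bipartite :
  wiener_index (line_graph G) =
  (1 / 2 * #|A|%:R * #|~: A|%:R
     * (2 * #|A|%:R * #|~: A|%:R - #|A|%:R - #|~: A|%:R))%R.
Proof.
have -> : wiener_index (line_graph G) =
    (1 / 2 * (\sum_(e : line_graph G) \sum_(f : line_graph G) dist e f)%:R)%R.
  congr (_ * _)%R; rewrite natr_sum; apply: eq_bigr => e _.
  by rewrite natr_sum.
rewrite sum_dist_line_bipartite.
(* The predecessors are truncated at zero: an empty class makes both sides vanish, and otherwise
   they are true subtractions. *)
case: #|A| => [|m]; first by rewrite !(mul0n, mul0r, mulr0).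
case: #|~: A| => [|n]; first by rewrite !(muln0, mul0n, mul0r, mulr0).
by rewrite /= !(natrM, natrD) -!(natr1 m, natr1 n); ring.
Qed.

End CompleteBipartite.

(** * Zero-divisors modulo a product of two primes *)

Lemma card_nonzero_multiples (d m : nat) :
  0 < d -> #|[set x : 'I_(d * m) | (d %| x) && (x != 0 :> nat)]| = m.-1.
Proof.
case: m => [|m] d0.
  by apply/eqP; rewrite cards_eq0; apply/eqP/setP => -[x]; rewrite muln0.
have lt_mul (k : 'I_m) : d * k.+1 < d * m.+1 by rewrite ltn_pmul2l // ltnS.
rewrite -[RHS]card_ord -(card_imset predT (f := fun k => Ordinal (lt_mul k))).
  apply: eq_card => x; rewrite !inE; apply/andP/imsetP => [[dx x0]|[k _ ->]] /=.
    have [[|k] xE] := dvdnP dx; first by rewrite xE in x0.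
    have km : k < m by have := ltn_ord x; rewrite xE mulnC ltn_pmul2l.
    by exists (Ordinal km) => //; apply: val_inj; rewrite /= xE mulnC.
  by split; [exact: dvdn_mulr | rewrite -lt0n muln_gt0 d0].
move=> k l /(congr1 val) /= /eqP; rewrite eqn_pmul2l // eqSS => /eqP.
exact: val_inj.
Qed.

Lemma Zp_mul_eq0 (n : nat) (x y : 'Z_n) : 1 < n ->
  (x * y == 0)%R = (n %| x * y).
Proof. by move=> n1; rewrite -val_eqE /= [X in _ %% X]Zp_cast. Qed.

Section TwoPrimes.
Variables p q : nat.
Hypotheses (hp : prime p) (hq : prime q) (pq : p != q).

Local Notation Z := 'Z_(p * q).

Let n_gt1 : 1 < p * q.
Proof. by have := prime_gt1 hp; have := prime_gt1 hq; nia. Qed.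

Let co_pq : coprime p q.
Proof. by rewrite prime_coprime // dvdn_prime2. Qed.

Lemma Zpq_ltn (x : Z) : x < p * q.
Proof. by rewrite -[leqRHS](Zp_cast n_gt1) ltn_ord. Qed.

Lemma Zpq_dvd (x : Z) : x != 0%R -> p %| x -> ~~ (q %| x).
Proof.
rewrite -val_eqE /= -lt0n => x0 px; apply/negP => qx.
have : p * q %| x by rewrite Gauss_dvd // px qx.
by move/(dvdn_leq x0); rewrite leqNgt Zpq_ltn.
Qed.

(** If [x * y] vanishes and [p] does not divide [x], then [p] divides [y], so [q] does not, and [q]
    must divide [x]. Conversely, [q] annihilates the multiples of [p], and [p] those of [q]. *)
Lemma Zpq_nz_zero_divisor (x : Z) :
  nz_zero_divisor x = (x != 0%R) && ((p %| x) || (q %| x)).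
Proof.
rewrite /nz_zero_divisor; case: eqVneq => //= x0.
apply/existsP/idP => [[y /andP[y0]]|].
  rewrite Zp_mul_eq0 // => /[dup].
  move=> /(dvdn_trans (dvdn_mulr q (dvdnn p))); rewrite Euclid_dvdM //.
  case/orP => [->//|py] /(dvdn_trans (dvdn_mull p (dvdnn q))).
  by rewrite Euclid_dvdM // (negbTE (Zpq_dvd _ y0 py)) orbF orbC => ->.
have valp : (p%:R : Z)%R = p :> nat.
  by rewrite val_Zp_nat // modn_small // ltn_Pmulr ?prime_gt0 ?prime_gt1.
have valq : (q%:R : Z)%R = q :> nat.
  by rewrite val_Zp_nat // modn_small // ltn_Pmull ?prime_gt0 ?prime_gt1.
case/orP => [px|qx]; [exists (q%:R)%R|exists (p%:R)%R].
  rewrite Zp_mul_eq0 // valq dvdn_mul // -val_eqE /= valq.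
  by rewrite -lt0n prime_gt0.
have := dvdn_mul qx (dvdnn p); rewrite (mulnC q) Zp_mul_eq0 // valp => ->.
by rewrite andbT -val_eqE /= valp -lt0n prime_gt0.
Qed.

Local Notation zdg := (zero_divisor_graph Z).

Lemma zdg_dvd (x : zdg) : (q %| val x) = ~~ (p %| val x).
Proof.
have := valP x; rewrite Zpq_nz_zero_divisor => /andP[x0].
by case: (boolP (p %| val x)) => //= px _; apply/negbTE/Zpq_dvd.
Qed.

(** Each vertex carries exactly one of the two primes, so a product vanishes exactly when its
    factors carry different ones; such factors are automatically distinct. *)
Lemma zdg_adj (x y : zdg) : adj x y = ((p %| val x) != (p %| val y)).
Proof.
rewrite /= /zd_adj Zp_mul_eq0 // Gauss_dvd // !Euclid_dvdM // !zdg_dvd.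
case: eqVneq => [->|_]; first by rewrite eqxx.
by case: (p %| _); case: (p %| _).
Qed.

(** Keeping [d] and [e] general lets one count serve both classes. *)
Lemma card_zdg (d e : nat) : 0 < d -> d * e = p * q ->
    (d == p) || (d == q) ->
  #|[set x : zdg | d %| val x]| = e.-1.
Proof.
move=> d0 deE dpq; rewrite -(card_nonzero_multiples d e d0).
have castE : (Zp_trunc (p * q)).+2 = d * e by rewrite Zp_cast.
rewrite -(card_imset _ (inj_comp (@cast_ord_inj _ _ castE) val_inj)).
apply: eq_card => x; rewrite !inE.
apply/imsetP/andP => [[y]|[dx x0]].
  rewrite inE => dy ->; split => //=; have := valP y.
  by rewrite Zpq_nz_zero_divisor => /andP[].
have zx : nz_zero_divisor (cast_ord (esym castE) x : Z).
  rewrite Zpq_nz_zero_divisor -val_eqE /= x0 /=.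
  by case/orP: dpq => /eqP <-; rewrite dx ?orbT.
by exists (Sub _ zx : zdg); rewrite ?inE //=; apply: val_inj.
Qed.

End TwoPrimes.

Theorem theorem3p7 (p q : nat) (hp : prime p) (hq : prime q)
    (h2p : (2 < p)%N) (hpq : (p < q)%N) :
  wiener_index (line_graph (zero_divisor_graph 'Z_(p * q))) =
  (1 / 2 * (p%:R - 1) * (q%:R - 1)
     * (2 * p%:R * q%:R - 3 * p%:R - 3 * q%:R + 4))%R :> rat.
Proof.
have pq : p != q by rewrite neq_ltn hpq.
pose A := [set x : zero_divisor_graph 'Z_(p * q) | p %| val x].
rewrite (@wiener_line_bipartite _ A) => [|x y]; last by rewrite !inE zdg_adj.
have -> : #|A| = q.-1 by apply: card_zdg; rewrite ?prime_gt0 ?eqxx.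
have -> : ~: A = [set x : zero_divisor_graph 'Z_(p * q) | q %| val x].
  by apply/setP=> x; rewrite !inE zdg_dvd.
rewrite (@card_zdg p q hp hq pq q p) ?prime_gt0 ?eqxx ?orbT // 1?mulnC //.
have [p0 q0] : 0 < p /\ 0 < q by rewrite !prime_gt0.
(* The last factor is [2(p-1)(q-1) - (p-1) - (q-1) = 2pq - 3p - 3q + 4]. *)
by rewrite -(prednK p0) -(prednK q0) /= -(natr1 p.-1) -(natr1 q.-1); ring.
Qed.
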